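(* Let $d\ge1$ and let $\mathbf X$ be a random vector in $\mathbb R^d$ with law $\mathbb P$ such that $\mathbb E\|\mathbf X\|<\infty$. Then for every $\delta>0$ there exist two constants $0<c_1<c_2$ such that $$c_1\|\mathbf z\|^{-1}\le D_\delta(\mathbf z|\mathbb P)\le c_2\|\mathbf z\|^{-1}$$ when $\|\mathbf z\|$ is large enough.
   Context: $\|\cdot\|$ is the Euclidean norm and $\langle\cdot,\cdot\rangle$ the Euclidean inner product. For laws $\mathbb P,\mathbb P'$ on $\mathbb R^d$ the Wasserstein distance is $d_W(\mathbb P,\mathbb P')=\inf_\Pi\int\|\mathbf x-\mathbf y\|\,\Pi(\mathrm d\mathbf x,\mathrm d\mathbf y)\in[0,\infty]$, over all joint laws $\Pi$ with marginals $\mathbb P,\mathbb P'$. The robustified halfspace depth is $$D_\delta(\mathbf z|\mathbb P)=\inf_{\|\mathbf u\|=1}\ \sup_{\mathbb P':d_W(\mathbb P',\mathbb P)\le\delta}\mathbb P'(\{\mathbf x\in\mathbb R^d:\langle\mathbf u,\mathbf x-\mathbf z\rangle\ge0\}).$$ *)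

(* Defs.v *)
From HB Require Import structures.
From mathcomp Require Import all_boot all_order all_algebra.
From mathcomp Require Import all_classical all_reals all_analysis.
Set Implicit Arguments.
Unset Strict Implicit.
Unset Printing Implicit Defensive.
Import Order.TTheory GRing.Theory Num.Theory.
Local Open Scope classical_set_scope.
Local Open Scope ring_scope.

(* R^d is d.-tuple R: its canonical sigma-algebra is the one generated by the
   coordinate maps, i.e. the Borel sigma-algebra of R^d.  (The norm that the
   library puts on row vectors is the sup norm, not the Euclidean one.) *)
Section euclidean_space.
Variables (R : realType) (d : nat).
Implicit Types x y : d.-tuple R.

Definition vsub x y : d.-tuple R := [tuple tnth x i - tnth y i | i < d].

Definition inner x y : R := \sum_(i < d) tnth x i * tnth y i.

Definition enorm x : R := Num.sqrt (inner x x).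

Definition halfspace (u z : d.-tuple R) : set (d.-tuple R) :=
  [set x | 0 <= inner u (vsub x z)].

End euclidean_space.

Section robust_depth.
Variables (R : realType) (d : nat).
Local Open Scope ereal_scope.

Definition coupling (P P' : probability (d.-tuple R) R) :
    set (probability (d.-tuple R * d.-tuple R)%type R) :=
  [set Pi | forall A : set (d.-tuple R), measurable A ->
    pushforward Pi fst A = P A /\ pushforward Pi snd A = P' A].

Definition wasserstein (P P' : probability (d.-tuple R) R) : \bar R :=
  ereal_inf [set \int[Pi]_w (enorm (vsub w.1 w.2))%:E | Pi in coupling P P'].

Definition robust_depth (delta : R) (P : probability (d.-tuple R) R)
    (z : d.-tuple R) : \bar R :=
  ereal_inf [set ereal_sup
      [set P' (halfspace u z) |
        P' in [set P' : probability (d.-tuple R) R |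
                 wasserstein P' P <= delta%:E]]
    | u in [set u : d.-tuple R | enorm u = 1%R]].

End robust_depth.

(* Main.v *)
Require Import Defs.
From HB Require Import structures.
From mathcomp Require Import all_boot all_order all_algebra.
From mathcomp Require Import ring lra.
From mathcomp Require Import all_classical all_reals all_analysis.
From mathcomp Require Import measurable_realfun.
Set Implicit Arguments.
Unset Strict Implicit.
Unset Printing Implicit Defensive.
Import Order.TTheory GRing.Theory Num.Theory.
Local Open Scope classical_set_scope.
Local Open Scope ring_scope.

(** Upper bound: for the direction [u = z / |z|], a point [x] of the halfspace
    satisfies [|z| <= <u, x> <= |x - y| + |y|] for every [y], so Markov's
    inequality under a nearly optimal coupling bounds the mass of the halfspace
    by [(delta + 1 + E|X|) / |z|].  Lower bound: moving a fraction
    [p = delta / (2 |z|)] of the mass of [P] to the point [z], which belongs to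
    every halfspace through [z], costs at most [p (|z| + E|X|) <= delta]. *)

(** * Euclidean inner product and norm: Cauchy-Schwarz and the triangle inequality *)

Section euclidean_space_theory.
Variables (R : realType) (d : nat).
Implicit Types (x y u z : d.-tuple R).

Lemma inner_ge0 x : 0 <= inner x x.
Proof. by apply: sumr_ge0 => i _; rewrite -expr2 sqr_ge0. Qed.

Lemma enorm_ge0 x : 0 <= enorm x.
Proof. exact: sqrtr_ge0. Qed.

Lemma enorm_sqr x : enorm x ^+ 2 = inner x x.
Proof. by rewrite sqr_sqrtr// inner_ge0. Qed.

Lemma innerC x y : inner x y = inner y x.
Proof. by apply: eq_bigr => i _; rewrite mulrC. Qed.

Lemma inner_vsubr u x y : inner u (vsub x y) = inner u x - inner u y.
Proof.
rewrite /inner -sumrB; apply: eq_bigr => i _.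
by rewrite tnth_mktuple mulrBr.
Qed.

Lemma enorm_vsubxx x : enorm (vsub x x) = 0.
Proof.
rewrite /enorm /inner big1 ?sqrtr0// => i _.
by rewrite tnth_mktuple subrr mul0r.
Qed.

Lemma enorm_eq0_tnth x i : enorm x = 0 -> tnth x i = 0.
Proof.
move=> x0; have /eqP := enorm_sqr x.
rewrite x0 expr0n /= eq_sym psumr_eq0 => [/allP/(_ i)|j _]; last first.
  by rewrite -expr2 sqr_ge0.
by rewrite mem_index_enum => /(_ isT); rewrite mulf_eq0 orbb => /eqP.
Qed.

Lemma inner_enorm_eq0 x y : enorm x = 0 -> inner x y = 0.
Proof.
by move=> x0; rewrite /inner big1// => i _; rewrite enorm_eq0_tnth// mul0r.
Qed.

(** Cauchy-Schwarz, from the nonnegativity of $\|a x + b y\|^2$ for suitable $a, b$. A vector of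
    norm zero is treated apart, since the argument divides by $\|x\|\|y\|$. *)
Lemma inner_abs_le x y : `|inner x y| <= enorm x * enorm y.
Proof.
have [x0|x0] := eqVneq (enorm x) 0.
  by rewrite inner_enorm_eq0// normr0 mulr_ge0// enorm_ge0.
have [y0|y0] := eqVneq (enorm y) 0.
  by rewrite innerC inner_enorm_eq0// normr0 mulr_ge0// enorm_ge0.
have xy0 : 0 < enorm x * enorm y.
  by rewrite mulr_gt0// lt_neqAle eq_sym enorm_ge0 ?x0 ?y0.
have sqE (a b : R) : \sum_(i < d) (a * tnth x i + b * tnth y i) ^+ 2 =
    a ^+ 2 * enorm x ^+ 2 + 2 * a * b * inner x y + b ^+ 2 * enorm y ^+ 2.
  rewrite !enorm_sqr /inner !mulr_sumr -!big_split /=.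
  by apply: eq_bigr => i _; ring.
have sq0 (a b : R) :
    0 <= a ^+ 2 * enorm x ^+ 2 + 2 * a * b * inner x y + b ^+ 2 * enorm y ^+ 2.
  by rewrite -sqE sumr_ge0// => i _; rewrite sqr_ge0.
(* With $a = \|y\|$ and $b = \pm\|x\|$ the quadratic form becomes $2\|x\|^2\|y\|^2 \pm
   2\|x\|\|y\|\langle x,y\rangle$; each sign yields one of the two bounds. *)
rewrite ler_norml; apply/andP; split; rewrite -(ler_pM2l xy0).
  by have := sq0 (enorm y) (enorm x); lra.
by have := sq0 (enorm y) (- enorm x); lra.
Qed.

(** After squaring and expanding, only $-\langle x,y\rangle \le \|x\|\|y\|$ is left, which is
    Cauchy-Schwarz. *)
Lemma enorm_vsub_le x y : enorm (vsub x y) <= enorm x + enorm y.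
Proof.
have h0 : 0 <= enorm x + enorm y by rewrite addr_ge0// enorm_ge0.
rewrite -(ler_pXn2r (ltn0Sn 1)) ?nnegrE ?enorm_ge0//.
rewrite enorm_sqr inner_vsubr ![inner (vsub x y) _]innerC !inner_vsubr.
rewrite -!enorm_sqr [inner y x]innerC.
have := inner_abs_le x y; rewrite ler_norml => /andP[h1 h2].
by lra.
Qed.

Lemma inner_le_enorm u x : enorm u = 1 -> inner u x <= enorm x.
Proof.
move=> u1; apply: le_trans (ler_norm _) _.
by rewrite -[leRHS]mul1r -u1 inner_abs_le.
Qed.

Lemma exists_unit_direction z : 0 < enorm z ->
  exists u, enorm u = 1 /\ inner u z = enorm z.
Proof.
move=> z0; pose u := [tuple (enorm z)^-1 * tnth z i | i < d].
have uE y : inner u y = (enorm z)^-1 * inner z y.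
  rewrite /inner mulr_sumr; apply: eq_bigr => i _.
  by rewrite tnth_mktuple mulrA.
have uz : inner u z = enorm z.
  by rewrite uE -enorm_sqr expr2 mulrA mulVf ?mul1r// gt_eqF.
exists u; split => //.
by rewrite /enorm uE innerC uz mulVf ?sqrtr1// gt_eqF.
Qed.

End euclidean_space_theory.

(** * Measurability of the norm, of differences and of halfspaces *)

Section euclidean_space_measurability.
Variables (R : realType) (d : nat) (disp : measure_display).
Variable T : measurableType disp.
Implicit Types f g : T -> d.-tuple R.

Lemma measurable_inner f g : measurable_fun setT f -> measurable_fun setT g ->
  measurable_fun setT (fun t => inner (f t) (g t)).
Proof.
move=> mf mg; apply: measurable_sum => i; apply: measurable_funM.
- exact: (measurableT_comp (measurable_tnth i) mf).
- exact: (measurableT_comp (measurable_tnth i) mg).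
Qed.

Lemma measurable_enorm f : measurable_fun setT f ->
  measurable_fun setT (fun t => enorm (f t)).
Proof.
move=> mf; apply: (measurableT_comp (f := @Num.sqrt R)).
  by apply: continuous_measurable_fun; exact: sqrt_continuous.
exact: measurable_inner.
Qed.

Lemma measurable_vsub f g : measurable_fun setT f -> measurable_fun setT g ->
  measurable_fun setT (fun t => vsub (f t) (g t)).
Proof.
move=> mf mg; apply/measurable_fun_tnthP => i.
rewrite (_ : _ \o _ = fun t => tnth (f t) i - tnth (g t) i); last first.
  by apply/funext => t /=; rewrite tnth_mktuple.
apply: measurable_funB.
- exact: (measurableT_comp (measurable_tnth i) mf).
- exact: (measurableT_comp (measurable_tnth i) mg).
Qed.

End euclidean_space_measurability.

Lemma measurable_halfspace (R : realType) (d : nat) (u z : d.-tuple R) :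
  measurable (halfspace u z).
Proof.
rewrite -[halfspace u z]setTI.
have -> : halfspace u z = (fun x => inner u (vsub x z)) @^-1` `[0, +oo[%classic.
  by apply/seteqP; split => x; rewrite /halfspace /= in_itv /= andbT.
apply: (measurable_inner (g := fun x => vsub x z)) => //.
exact: (measurable_vsub (f := id) (g := cst z)).
Qed.

(** * Convex combinations of two probability measures *)

Section mixture.
Variables (R : realType) (disp : measure_display) (T : measurableType disp).
Local Open Scope ereal_scope.

(** The formula on sets serves to compute marginals and masses of halfspaces, the one on integrals
    to compute transport costs. *)
Lemma exists_mixture (P0 P1 : probability T R) (p : R) :
  (0 <= p)%R -> (p <= 1)%R ->
  exists P : probability T R,
    (forall A, P A = (1 - p)%:E * P0 A + p%:E * P1 A) /\
    (forall f : T -> \bar R, measurable_fun setT f -> (forall x, 0 <= f x) ->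
      \int[P]_x f x = (1 - p)%:E * \int[P0]_x f x + p%:E * \int[P1]_x f x).
Proof.
move=> p0 p1; have q0 : (0 <= 1 - p)%R by rewrite subr_ge0.
pose m := measure_add (mscale (NngNum q0) P0) (mscale (NngNum p0) P1).
have mE A : m A = (1 - p)%:E * P0 A + p%:E * P1 A by rewrite /m measure_addE.
have mT : m setT = 1.
  by rewrite mE !probability_setT !mule1 -EFinD subrK.
pose m' : set T -> \bar R := m.
pose P : probability T R :=
  HB.pack m' (Measure.on m) (Measure_isProbability.Build _ _ _ m' mT).
exists P; split => [//|f mf f0].
transitivity (\int[m]_x f x); first by apply: eq_measure_integral.
by rewrite ge0_integral_measure_add// !ge0_integral_mscale.
Qed.

End mixture.

(** * The two bounds on the depth of a law with finite first moment $m$ *)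

Section robust_depth_bounds.
Variables (R : realType) (d : nat) (delta : R).
Variable P : probability (d.-tuple R) R.
Hypothesis P1 : (\int[P]_x (enorm x)%:E < +oo)%E.
Local Notation E := (d.-tuple R).
Local Notation m := (fine (\int[P]_x (enorm x)%:E)).

Let measurable_enormE : measurable_fun setT (fun x : E => (enorm x)%:E).
Proof. by apply/measurable_EFinP; exact: (measurable_enorm (f := id)). Qed.

Let measurable_dist :
  measurable_fun setT (fun w : E * E => (enorm (vsub w.1 w.2))%:E).
Proof. by apply/measurable_EFinP/measurable_enorm/measurable_vsub. Qed.

Lemma first_momentE : (\int[P]_x (enorm x)%:E)%E = m%:E.
Proof.
rewrite fineK// ge0_fin_numE//.
by apply: integral_ge0 => x _; rewrite lee_fin enorm_ge0.
Qed.

Lemma first_moment_ge0 : 0 <= m.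
Proof.
by apply/fine_ge0/integral_ge0 => x _; rewrite lee_fin enorm_ge0.
Qed.

Lemma robust_depth_le z : 0 < enorm z ->
  (robust_depth delta P z <= ((delta + 1 + m) * (enorm z)^-1)%:E)%E.
Proof.
move=> z0; have [u [u1 uz]] := exists_unit_direction z0.
apply: le_trans; first by apply: ereal_inf_lbound; exists u; [exact: u1|].
apply: ge_ereal_sup => _ [P' /= P'd <-].
(* The slack $1$ makes the inequality strict, so that some coupling has cost below $\delta + 1$
   without any claim that the infimum is attained. *)
have /ereal_inf_lt : (wasserstein P' P < (delta + 1)%:E)%E.
  by apply: le_lt_trans P'd _; rewrite lte_fin ltrDl.
move=> [_ [Pi Pic <-]] /ltW cost.
have mH := @measurable_halfspace R d u z.
rewrite -(Pic _ mH).1 /pushforward.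
(* The function for Markov's inequality: it is at least $\|z\|$ as soon as the first coordinate lies
   in the halfspace, and its integral splits into the transport cost and $m$. *)
pose g (w : E * E) := ((enorm (vsub w.1 w.2))%:E + (enorm w.2)%:E)%E.
have g0 w : (0 <= g w)%E by rewrite adde_ge0// lee_fin enorm_ge0.
have m2 : measurable_fun setT (fun w : E * E => (enorm w.2)%:E).
  by apply/measurable_EFinP/measurable_enorm.
have mg : measurable_fun setT g by apply: emeasurable_funD.
have sub : fst @^-1` halfspace u z `<=`
    setT `&` [set w | ((enorm z)%:E <= `|g w|)%E].
  move=> w; rewrite /halfspace/= inner_vsubr uz subr_ge0 => zw; split => //.
  suff : ((enorm z)%:E <= `|g w|)%E by [].
  rewrite gee0_abs// /g -EFinD lee_fin (le_trans zw)//.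
  have := inner_le_enorm (vsub w.1 w.2) u1.
  have := inner_le_enorm w.2 u1.
  by rewrite inner_vsubr; lra.
rewrite EFinM lee_pdivlMr// muleC.
have mH1 : measurable (fst @^-1` halfspace u z : set (E * E)).
  by rewrite -[_ @^-1` _]setTI; exact: measurable_fst.
apply: (@le_trans _ _ (\int[Pi]_w `|g w|)%E).
  apply: le_trans (le_integral_abse _ measurableT mg z0).
  rewrite lee_pmul2l//; apply: le_measure sub; rewrite inE//.
  by apply: emeasurable_fun_c_infty => //; exact: measurableT_comp.
under eq_integral do rewrite gee0_abs//.
rewrite ge0_integralD//; try by move=> w _; rewrite lee_fin enorm_ge0.
rewrite [leRHS]EFinD leeD// -first_momentE.
(* The second marginal of [Pi] is [P], so the second summand of [g] integrates to $m$. *)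
rewrite [leRHS](eq_measure_integral (pushforward Pi snd)); last first.
  by move=> A mA _; exact: (esym (Pic _ mA).2).
rewrite ge0_integral_pushforward//.
by move=> x _; rewrite lee_fin enorm_ge0.
Qed.

(** The bound $\delta \le \|z\|$ makes $p$ a probability, and $m \le \|z\|$ gives $p(\|z\| + m) \le
    2p\|z\| = \delta$. *)
Lemma robust_depth_ge z : 0 < delta -> delta <= enorm z -> m <= enorm z ->
  ((delta / 2 * (enorm z)^-1)%:E <= robust_depth delta P z)%E.
Proof.
move=> delta0 dz mz; have z0 : 0 < enorm z by apply: lt_le_trans dz.
set p := delta / 2 * (enorm z)^-1.
have p0 : 0 <= p by rewrite mulr_ge0// ?invr_ge0 ?enorm_ge0//; lra.
have p1 : p <= 1 by rewrite ler_pdivrMr//; lra.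
have mdiag : measurable_fun setT (fun x : E => (x, x)).
  exact: measurable_fun_pair.
have mcst : measurable_fun setT (fun x : E => (z, x)).
  exact: measurable_fun_pair.
(* The coupling is built before [P']: with $X$ of law [P], it mixes the laws of $(X, X)$ and $(z,
   X)$ with weights $1-p$ and $p$. [P'] is then its first marginal by definition, and only the
   second one has to be checked. *)
pose diag : {mfun E >-> (E * E)%type} := mfun_Sub (mem_set mdiag).
pose jump : {mfun E >-> (E * E)%type} := mfun_Sub (mem_set mcst).
have [Pi [PiE PiI]] :=
  exists_mixture (distribution P diag) (distribution P jump) p0 p1.
pose fstm : {mfun (E * E)%type >-> E} := mfun_Sub (mem_set measurable_fst).
pose P' := distribution Pi fstm.
have P'd : (wasserstein P' P <= delta%:E)%E.
  apply: (@le_trans _ _ (\int[Pi]_w (enorm (vsub w.1 w.2))%:E)%E).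
    apply: ereal_inf_lbound; exists Pi => // A mA; split => //.
    rewrite /pushforward PiE /distribution /pushforward/=.
    rewrite -ge0_muleDl ?lee_fin// ?subr_ge0//.
    by rewrite -EFinD subrK mul1e.
  have dist0 w : (0 <= (enorm (vsub w.1 w.2) : R)%:E)%E.
    by rewrite lee_fin enorm_ge0.
  rewrite PiI// !ge0_integral_distribution//=.
  (* The diagonal part moves no mass and costs nothing. *)
  rewrite (eq_integral (cst 0%E)); last first.
    by move=> x _ /=; rewrite enorm_vsubxx.
  rewrite integral0 mule0 add0e.
  apply: (@le_trans _ _ (p%:E * (\int[P]_x ((enorm z)%:E + (enorm x)%:E)))%E).
    apply: lee_wpmul2l; first by rewrite lee_fin.
    apply: ge0_le_integral => //.
    - by move=> x _; rewrite lee_fin enorm_ge0.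
    - exact: (measurableT_comp measurable_dist mcst).
    - by apply: emeasurable_funD.
    - by move=> x _; rewrite -EFinD lee_fin enorm_vsub_le.
  rewrite ge0_integralD//; try by move=> x _; rewrite lee_fin enorm_ge0.
  rewrite integral_cst//= probability_setT mule1 first_momentE -EFinD -EFinM.
  rewrite lee_fin /p mulrAC ler_pdivrMr//.
  by nra.
apply/ereal_infP => _ [u u1 <-].
apply: (@le_trans _ _ (P' (halfspace u z))); last first.
  by apply: ereal_sup_ubound; exists P'.
(* All the moved mass sits at $z$, on the boundary of the closed halfspace, whatever [u] is; hence
   [P'] gives the halfspace at least $p$. *)
have jump1 : distribution P jump (fst @^-1` halfspace u z) = 1%E.
  rewrite -(probability_setT P); congr (P _).
  apply/seteqP; split => // x _.
  by rewrite /halfspace /= inner_vsubr subrr.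
rewrite (_ : P' _ = Pi (fst @^-1` halfspace u z))// PiE [X in (_ + _ * X)%E]jump1.
by rewrite mule1 leeDr// mule_ge0// lee_fin subr_ge0.
Qed.

End robust_depth_bounds.

Theorem corollary2 (R : realType) (d : nat) (hd : (1 <= d)%N)
    (disp : measure_display) (Omega : measurableType disp)
    (Q : probability Omega R) (X : {RV Q >-> d.-tuple R})
    (hX : ('E_Q[fun w => enorm (X w)] < +oo)%E)
    (delta : R) (hdelta : 0 < delta) :
  exists c1 c2 : R,
    [/\ 0 < c1, c1 < c2 &
      exists r : R, forall z : d.-tuple R, r <= enorm z ->
        ((c1 * (enorm z)^-1)%:E <= robust_depth delta (distribution Q X) z /\
         robust_depth delta (distribution Q X) z <= (c2 * (enorm z)^-1)%:E)%E].
Proof.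
have P1 : (\int[distribution Q X]_x (enorm x)%:E < +oo)%E.
  rewrite ge0_integral_distribution//.
  - by move: hX; rewrite unlock.
  - by apply/measurable_EFinP; exact: (measurable_enorm (f := id)).
  - by move=> x; rewrite lee_fin enorm_ge0.
set m := fine (\int[distribution Q X]_x (enorm x)%:E).
have m0 : 0 <= m by exact: first_moment_ge0.
exists (delta / 2), (delta + 1 + m); split; [lra|lra|].
(* This threshold exceeds neither summand's requirement: as $\delta > 0$ and $m \ge 0$, it forces
   $\|z\| > 0$, $\delta \le \|z\|$ and $m \le \|z\|$ at once. *)
exists (delta + m) => z rz; split.
- by apply: robust_depth_ge => //; rewrite -/m; lra.
- by apply: robust_depth_le => //; lra.
Qed.
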